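(* For integers $p',q',r'$ let $\min(p',q',r';|E|)$ denote the minimum of $|E(G)|$ over all connected finite simple graphs $G$ with $\mathrm{ind\text{-}match}(G)=p'$, $\mathrm{min\text{-}match}(G)=q'$ and $\mathrm{match}(G)=r'$. Let $q,r$ be integers with $2\le q\le r\le 2q-2$. Then: (1) $\min(1,q,q;|E|)\le q^2$; (2) $\min(1,q,q+1;|E|)\le q^2+2$; (3) if $q+2\le r\le 2q-2$, then $\min(1,q,r;|E|)\le \min\{f_1(q,r),f_2(q,r)\}$, where $f_1(q,r)=r(q-1)+\binom{r-q+2}{2}$ and $f_2(q,r)=2(r-q)+\binom{2q}{2}$.
   Context: All graphs are finite and simple. A matching of $G$ is a set of pairwise disjoint edges. A maximal matching is a matching not properly contained in another matching. An induced matching is a matching $M$ such that for distinct $e,f\in M$ there is no edge $g$ of $G$ meeting both $e$ and $f$. $\mathrm{match}(G)$ is the maximum size of a matching, $\mathrm{min\text{-}match}(G)$ the minimum size of a maximal matching, and $\mathrm{ind\text{-}match}(G)$ the maximum size of an induced matching of $G$. *)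

(* Defs.v *)
From HB Require Import structures.
From mathcomp Require Import all_boot.

Set Implicit Arguments.
Unset Strict Implicit.
Unset Printing Implicit Defensive.

Record sgraph := SGraph {
  vertex :> finType;
  adj : rel vertex;
  adj_sym : symmetric adj;
  adj_irrefl : irreflexive adj }.

Section Invariants.
Variable G : sgraph.

Definition edges : {set {set G}} :=
  [set [set u.1; u.2] | u : G * G & adj u.1 u.2].

Definition connected : bool :=
  (0 < #|G|) && [forall x : G, forall y : G, connect (@adj G) x y].

(* trivIset: distinct members are disjoint (set0 is not an edge). *)
Definition matching (M : {set {set G}}) : bool :=
  (M \subset edges) && trivIset M.

Definition maximal_matching (M : {set {set G}}) : bool := maxset matching M.

Definition induced_matching (M : {set {set G}}) : bool :=
  matching M &&
  [forall e in M, forall f in M, (e != f) ==>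
     ~~ [exists g in edges, ~~ [disjoint g & e] && ~~ [disjoint g & f]]].

Definition match_num : nat := \max_(M | matching M) #|M|.

Definition ind_match : nat := \max_(M | induced_matching M) #|M|.

Lemma matching0 : matching set0.
Proof. by rewrite /matching sub0set; apply/trivIsetP=> A B; rewrite inE. Qed.

Lemma ex_maximal_matching_card :
  exists n, [exists M, maximal_matching M && (#|M| == n)].
Proof.
have [M maxM _] := maxset_exists matching0.
by exists #|M|; apply/existsP; exists M; rewrite /maximal_matching maxM eqxx.
Qed.

Definition min_match : nat := ex_minn ex_maximal_matching_card.

End Invariants.

Definition has_invariants (p q r : nat) (G : sgraph) : Prop :=
  [/\ connected G, ind_match G = p, min_match G = q & match_num G = r].

(* m is min(p, q, r; |E|): the minimum exists and equals m. *)
Definition is_min_edges (p q r m : nat) : Prop :=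
  (exists2 G : sgraph, has_invariants p q r G & #|edges G| = m) /\
  (forall G : sgraph, has_invariants p q r G -> m <= #|edges G|).

Definition f1 (q r : nat) : nat := r * (q - 1) + 'C(r - q + 2, 2).

Definition f2 (q r : nat) : nat := 2 * (r - q) + 'C(2 * q, 2).

(* Main.v *)
(** One bipartite graph serves for all three bounds.  Put d = r - q and let the
    biadjacency matrix be the Ferrers diagram that is the union of the q x q
    square and the staircase of height r.  Neighbourhoods in a Ferrers diagram
    are nested, so any two edges are joined by an edge; the antidiagonal of the
    staircase is a perfect matching of size r; and the smallest maximal matching
    has the size of the Durfee square, which is q since r <= 2q.  The diagram has
    q^2 + d(d+1) cells: q^2 for d = 0, q^2 + 2 for d = 1, and at most
    min(f1, f2) for 2 <= d <= q - 2, as f1 - q^2 - d(d+1) = (d-1)(2q-d-2)/2. *)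

Require Import Defs.
From Stdlib Require Import Classical.
From mathcomp Require Import all_boot zify.

(** * Matchings in an arbitrary graph *)

Section Matchings.
Variable G : sgraph.
Implicit Types (M : {set {set G}}) (e : {set G}).

Lemma card_edge e : e \in edges G -> #|e| = 2.
Proof.
case/imsetP=> -[x y] /=; rewrite inE /= => xy ->.
by rewrite cards2; case: eqP xy => // ->; rewrite adj_irrefl.
Qed.

Lemma card_matching M : matching M -> #|M|.*2 <= #|G|.
Proof.
case/andP=> /subsetP sM /eqP tM.
rewrite -mul2n mulnC -sum_nat_const.
have -> : \sum_(e in M) 2 = \sum_(e in M) #|e|.
  by apply: eq_bigr => e /sM /card_edge.
by rewrite tM max_card.
Qed.

(** An edge missing every member of [M] could be adjoined to it; conversely, a new edge of a larger
    matching would be disjoint from all of [M]. *)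
Lemma maximal_matchingP M :
  reflect (matching M /\
           forall e, e \in edges G -> exists2 f, f \in M & ~~ [disjoint e & f])
          (maximal_matching M).
Proof.
apply: (iffP idP) => [/maxsetP[mM maxM]|[mM meetM]].
  split=> [//|e eG]; apply/exists_inP; apply: contraT => dis.
  have disM : {in M, forall f : {set G}, [disjoint e & f]}.
    move=> f fM; apply: contraNT dis => ef.
    by apply/exists_inP; exists f.
  case/andP: (mM) => sM tM.
  (* Only the empty set is disjoint from itself, so excluding it gives [e \notin M]. *)
  have n0 : set0 \notin M.
    by apply/negP=> /(subsetP sM) /card_edge; rewrite cards0.
  have [tU eM] := trivIsetU1 disM tM n0.
  suff UM : e |: M = M by rewrite -UM setU11 in eM.
  apply: maxM; last exact: subsetUr.
  by rewrite /matching tU subUset sub1set eG sM.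
apply/maxsetP; split=> // N /andP[sN /trivIsetP tN] MN; apply/eqP.
rewrite eqEsubset MN andbT; apply/subsetP=> e eN.
have [f fM ef] := meetM e (subsetP sN e eN).
have [-> //|ne] := eqVneq e f.
by case/negP: ef; apply: tN => //; exact: (subsetP MN).
Qed.

End Matchings.

(** * The Ferrers graph and its invariants *)

Section FerrersGraph.
Variables q r : nat.
Hypotheses (q_gt0 : 0 < q) (q_le_r : q <= r) (r_le_2q : r <= 2 * q).

(* Row and column indices start at 0. *)
Definition cell (i j : nat) : bool := (i < q) && (j < q) || (i + j < r).

(** The boolean is the side: [false] for rows, [true] for columns. The diagram is symmetric, so it
    does not matter which endpoint is the row. *)
Definition ferrers_adj : rel (bool * 'I_r) :=
  [rel u v : bool * 'I_r | (u.1 != v.1) && cell u.2 v.2].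

Lemma cell_sym i j : cell i j = cell j i.
Proof. by rewrite /cell andbC addnC. Qed.

Lemma ferrers_sym : symmetric ferrers_adj.
Proof. by move=> u v; rewrite /ferrers_adj /= eq_sym cell_sym. Qed.

Lemma ferrers_irrefl : irreflexive ferrers_adj.
Proof. by move=> u; rewrite /ferrers_adj /= eqxx. Qed.

Definition ferrers : sgraph := SGraph ferrers_sym ferrers_irrefl.

Definition cell_edge (i j : 'I_r) : {set ferrers} := [set (false, i); (true, j)].

Lemma mem_cell_edge b k i j :
  ((b, k) \in cell_edge i j) = (k == if b then j else i).
Proof. by rewrite !inE !xpair_eqE; case: b; rewrite ?orbF. Qed.

Lemma meets_cell_edges b k (e f : {set ferrers}) :
  (b, k) \in e -> (b, k) \in f -> ~~ [disjoint e & f].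
Proof. by move=> ke kf; apply/pred0Pn; exists (b, k); rewrite /= ke kf. Qed.

Lemma ferrers_edgesP (e : {set ferrers}) :
  reflect (exists i j : 'I_r, cell i j /\ e = cell_edge i j) (e \in edges ferrers).
Proof.
apply: (iffP imsetP) => [[[[b i] [c j]]]|[i [j [ij ->]]]]; last first.
  by exists ((false, i), (true, j)); rewrite ?inE.
rewrite inE /= /ferrers_adj /= => /andP[bc ij] ->.
case: b c bc => [] [] // _; last by exists i, j.
by exists j, i; rewrite cell_sym; split=> //; rewrite /cell_edge setUC.
Qed.

Lemma cell_le (i j i' j' : nat) : i' <= i -> j' <= j -> cell i j -> cell i' j'.
Proof. rewrite /cell; lia. Qed.

(** Row 0 and column 0 are full, so row 0 reaches every vertex in at most two steps. *)
Lemma ferrers_connected : connected ferrers.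
Proof.
have r0 : 0 < r by lia.
pose o : 'I_r := Ordinal r0.
have c0 (k : 'I_r) : cell o k by rewrite /cell /= add0n ltn_ord orbT.
have symc : connect_sym (@adj ferrers) by apply: sym_connect_sym; exact: adj_sym.
have hub (x : ferrers) : connect (@adj ferrers) (false, o) x.
  have adj_o b c (k : 'I_r) : b != c -> @adj ferrers (b, o) (c, k).
    by rewrite /= /ferrers_adj /= => ->; exact: c0.
  case: x => -[] k; first exact/connect1/adj_o.
  apply: (@connect_trans _ _ (true, o)); exact/connect1/adj_o.
apply/andP; split; first by apply/card_gt0P; exists (false, o).
apply/forallP=> x; apply/forallP=> y.
by apply: connect_trans (hub y); rewrite symc.
Qed.

(** Distinct indices separate the rows, injectivity of [s] the columns. It is applied to the
    antidiagonal and to the diagonal of the square. *)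
Lemma matching_graph (s : 'I_r -> 'I_r) (A : {set 'I_r}) :
  injective s -> {in A, forall i : 'I_r, cell i (s i)} ->
  matching [set cell_edge i (s i) | i in A] /\
  #|[set cell_edge i (s i) | i in A]| = #|A|.
Proof.
move=> sI cA; split; last first.
  apply: card_imset => i i' /setP /(_ (false, i)).
  by rewrite !mem_cell_edge eqxx => /esym /eqP.
apply/andP; split.
  by apply/subsetP=> _ /imsetP[i iA ->]; apply/ferrers_edgesP; exists i, (s i); auto.
apply/trivIsetP=> _ _ /imsetP[i iA ->] /imsetP[j jA ->] ne.
have {}ne : i != j by apply: contraNneq ne => ->.
apply/pred0P=> -[b k] /=; rewrite !mem_cell_edge; apply/negP=> /andP[/eqP-> ].
by case: b => /eqP; [move/sI|] => /eqP; rewrite (negbTE ne).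
Qed.

Lemma ferrers_match_num : match_num ferrers = r.
Proof.
apply/eqP; rewrite eqn_leq; apply/andP; split.
  apply/bigmax_leqP=> M /card_matching.
  by rewrite card_prod card_bool card_ord -mul2n leq_pmul2l.
(* The indices of an antidiagonal cell sum to [r - 1], so it lies in the staircase. *)
have [||mM cM] := @matching_graph (@rev_ord r) setT; first exact: rev_ord_inj.
  by move=> i _; have := ltn_ord i; rewrite /cell /=; lia.
rewrite -[X in X <= _](card_ord r) -cardsT -cM.
exact: (leq_bigmax_cond (F := fun M : {set {set ferrers}} => #|M|)).
Qed.

Lemma ferrers_ind_match : ind_match ferrers = 1.
Proof.
have r0 : 0 < r by lia.
apply/eqP; rewrite eqn_leq; apply/andP; split.
  apply/bigmax_leqP=> M /andP[/andP[/subsetP sM _] indM].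
  apply/card_le1_eqP=> f e fM eM; apply/eqP; apply: contraT => ne.
  move/forall_inP: indM => /(_ e eM) /forall_inP /(_ f fM); rewrite ne /=.
  case/negP.
  have /ferrers_edgesP[i [j [ij ->]]] := sM e eM.
  have /ferrers_edgesP[i' [j' [ij' ->]]] := sM f fM.
  (* The smaller row contains both columns, so it supplies the joining edge. *)
  apply/exists_inP; have [le|/ltnW le] := leqP i i'.
    exists (cell_edge i j').
      by apply/ferrers_edgesP; exists i, j'; split=> //; apply: cell_le ij'.
    rewrite (@meets_cell_edges false i) ?mem_cell_edge //=.
    by rewrite (@meets_cell_edges true j') ?mem_cell_edge.
  exists (cell_edge i' j).
    by apply/ferrers_edgesP; exists i', j; split=> //; apply: cell_le ij.
  rewrite (@meets_cell_edges true j) ?mem_cell_edge //=.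
  by rewrite (@meets_cell_edges false i') ?mem_cell_edge.
pose o : 'I_r := Ordinal r0.
rewrite -(cards1 (cell_edge o o)).
apply: (leq_bigmax_cond (F := fun M : {set {set ferrers}} => #|M|)).
apply/andP; split.
  apply/andP; split; last by apply/trivIsetP=> e f /set1P-> /set1P->; rewrite eqxx.
  rewrite sub1set; apply/ferrers_edgesP; exists o, o; split=> //.
  by rewrite /cell /= r0 orbT.
by apply/forall_inP=> e /set1P->; apply/forall_inP=> f /set1P->; rewrite eqxx.
Qed.

(** Pigeonhole: an edge has one vertex on side [b], so sending a covered vertex to its edge is
    injective. *)
Lemma unmatched_in_square (M : {set {set ferrers}}) b :
  matching M -> #|M| < q ->
  exists2 i : 'I_r, i < q & forall e, e \in M -> (b, i) \notin e.
Proof.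
case/andP=> /subsetP sM tM ltM.
have [i] : exists i : 'I_q, (b, widen_ord q_le_r i) \notin cover M.
  apply/existsP; rewrite -negb_forall; apply/negP=> /forallP cov.
  move: ltM; rewrite ltnNge -(card_ord q) => /negP; apply.
  pose f (i : 'I_q) := pblock M ((b, widen_ord q_le_r i) : ferrers).
  rewrite -(@card_imset _ _ f) => [|i j fij].
    apply: subset_leq_card; apply/subsetP=> _ /imsetP[i _ ->].
    exact: pblock_mem.
  have fi : (b, widen_ord q_le_r i) \in f i by rewrite mem_pblock.
  have fj : (b, widen_ord q_le_r j) \in f i by rewrite fij mem_pblock.
  have /ferrers_edgesP[k [l [_ fE]]] := sM _ (pblock_mem (cov i)).
  move: fi fj; rewrite -/(f i) in fE.
  rewrite fE !mem_cell_edge => /eqP<- /eqP /(congr1 val) /= ij.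
  exact/val_inj.
move=> ncov; exists (widen_ord q_le_r i); first exact: (ltn_ord i).
move=> e eM; apply: contraNN ncov => ie.
by apply/bigcupP; exists e.
Qed.

(** The diagonal of the square is a maximal matching of size [q]. A smaller matching misses a row
    and a column of the square, whose common cell is an edge it does not meet. *)
Lemma ferrers_min_match : min_match ferrers = q.
Proof.
rewrite /min_match; case: ex_minnP => n /existsP[M /andP[]].
move=> /maximal_matchingP[mM maxM] /eqP <- {n} minM.
apply/eqP; rewrite eqn_leq; apply/andP; split.
  apply: minM; apply/existsP.
  pose A : {set 'I_r} := [set widen_ord q_le_r i | i : 'I_q].
  have memA (i : 'I_r) : (i \in A) = (i < q).
    apply/imsetP/idP => [[k _ ->]|iq]; first exact: (ltn_ord k).
    by exists (Ordinal iq) => //; apply/val_inj.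
  have cA : #|A| = q.
    by rewrite card_imset ?card_ord // => i j /(congr1 val) /= ij; apply/val_inj.
  have [|mA mcA] := @matching_graph id A (@inj_id _).
    by move=> i; rewrite memA /cell => ->.
  exists [set cell_edge i i | i in A]; rewrite mcA cA eqxx andbT.
  apply/maximal_matchingP; split=> // e /ferrers_edgesP[i [j [ij ->]]].
  have [iq|qi] := ltnP i q.
    exists (cell_edge i i).
      by apply: (imset_f (fun k => cell_edge k k)); rewrite memA.
    by apply: (@meets_cell_edges false i); rewrite mem_cell_edge.
  exists (cell_edge j j); last first.
    by apply: (@meets_cell_edges true j); rewrite mem_cell_edge.
  apply: (imset_f (fun k => cell_edge k k)); rewrite memA.
  (* A cell in row [i >= q] has [i + j < r <= 2 * q], hence [j < q]. *)
  by move: ij; rewrite /cell; lia.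
rewrite leqNgt; apply/negP=> ltM.
have [i iq ni] := unmatched_in_square _ false mM ltM.
have [j jq nj] := unmatched_in_square _ true mM ltM.
have [|f fM /pred0Pn[[b k] /=]] := maxM (cell_edge i j).
  by apply/ferrers_edgesP; exists i, j; rewrite /cell iq jq.
rewrite mem_cell_edge => /andP[/eqP->]; case: b.
  exact/negP/nj.
exact/negP/ni.
Qed.

(** * Counting the cells *)

Lemma card_ord_lt m : #|[set j : 'I_r | j < m]| <= m.
Proof.
rewrite cardE -(size_map val) -[X in _ <= X](size_iota 0).
apply: uniq_leq_size; first by rewrite map_inj_uniq ?enum_uniq //; exact: val_inj.
by move=> _ /mapP[j jm ->]; rewrite mem_enum inE in jm; rewrite mem_iota.
Qed.

Lemma sum_staircase d n : (\sum_(i < n) (d - i)) * 2 <= d * d.+1.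
Proof.
(* The added term is twice the sum of the remaining rows; it carries the induction. *)
suff : (\sum_(i < n) (d - i)) * 2 + (d - n) * (d - n).+1 <= d * d.+1.
  by apply: leq_trans; exact: leq_addr.
elim: n => [|n IHn]; first by rewrite big_ord0 subn0.
rewrite big_ord_recr /=; apply: leq_trans IHn.
by rewrite subnS; case: (d - n) => [|k] /=; nia.
Qed.

(** Outside the square lie two staircases of height [r - q], one to its right and one below it, each
    with at most half of [(r - q) * (r - q).+1] cells. *)
Lemma ferrers_card_edges :
  #|edges ferrers| <= q ^ 2 + (r - q) * (r - q).+1.
Proof.
pose D (i : 'I_r) := [set j : 'I_r | cell i j].
have sub : edges ferrers \subset \bigcup_i [set cell_edge i j | j in D i].
  apply/subsetP=> _ /ferrers_edgesP[i [j [ij ->]]].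
  by apply/bigcupP; exists i => //; apply: imset_f; rewrite inE.
have bigcup_le : #|\bigcup_i [set cell_edge i j | j in D i]| <= \sum_i #|D i|.
  elim/big_rec2: _ => [|i n A _ IH]; first by rewrite cards0.
  apply: leq_trans (leq_card_setU _ _) _.
  by apply: leq_add IH; exact: leq_imset_card.
apply: leq_trans (subset_leq_card sub) _; apply: leq_trans bigcup_le _.
(* With truncated subtraction, the first branch is the maximum of [q] and [r - i]. *)
pose w i := if i < q then q + (r - q - i) else r - i.
have row i : #|D i| <= w i.
  apply: leq_trans (card_ord_lt _).
  apply: subset_leq_card; apply/subsetP=> j; rewrite !inE /cell /w.
  by case: ifP; lia.
have sum_row : \sum_i #|D i| <= \sum_(i < r) w i by apply: leq_sum => i _.
apply: leq_trans sum_row _.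
have -> : \sum_(i < r) w i = \sum_(i < q + (r - q)) w i by rewrite subnKC.
rewrite big_split_ord /=.
rewrite (eq_bigr (fun i : 'I_q => q + (r - q - i))) => [|i _]; last first.
  by rewrite /w ltn_ord.
rewrite [X in _ + X](eq_bigr (fun i : 'I_(r - q) => r - q - i)) => [|i _]; last first.
  by rewrite /w /= ltnNge leq_addr /= subnDA.
rewrite big_split /= sum_nat_const card_ord.
have := sum_staircase (r - q) q; have := sum_staircase (r - q) (r - q).
rewrite -mulnn -addnA leq_add2l.
by move: (_ * _.+1) (\sum_(i < q) _) (\sum_(i < r - q) _); lia.
Qed.

Lemma ferrers_has_invariants : has_invariants 1 q r ferrers.
Proof.
split; [exact: ferrers_connected | exact: ferrers_ind_match |
        exact: ferrers_min_match | exact: ferrers_match_num].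
Qed.

End FerrersGraph.

(** * From one graph to the minimum *)

Lemma min_edges_le {p q r : nat} {G : sgraph} :
  has_invariants p q r G -> exists2 m, is_min_edges p q r m & m <= #|edges G|.
Proof.
have [n] := ubnP #|edges G|; elim: n G => // n IHn G ltn hG.
(* Either a graph with fewer edges allows descent, or [G] attains the minimum. The question ranges
   over all graphs, so it is split classically. *)
case: (classic (exists2 H, has_invariants p q r H & #|edges H| < #|edges G|)).
  case=> H hH lt; have [|m hm le] := IHn H _ hH; first exact: leq_trans lt _.
  by exists m => //; apply: leq_trans le (ltnW lt).
move=> minG; exists #|edges G| => //; split; first by exists G.
by move=> H hH; rewrite leqNgt; apply/negP=> lt; apply: minG; exists H.
Qed.

Lemma min_edges_le_ferrers q r :
  0 < q -> q <= r -> r <= 2 * q ->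
  exists2 m, is_min_edges 1 q r m & m <= q ^ 2 + (r - q) * (r - q).+1.
Proof.
move=> q0 qr rq.
have [m hm le] := min_edges_le (ferrers_has_invariants q r q0 qr rq).
by exists m => //; apply: leq_trans le _; exact: ferrers_card_edges.
Qed.

Theorem theorem3p2 (q r : nat) (hq : 2 <= q) (hqr : q <= r)
    (hr : r <= 2 * q - 2) :
  [/\ exists2 m, is_min_edges 1 q q m & m <= q ^ 2,
      exists2 m, is_min_edges 1 q (q + 1) m & m <= q ^ 2 + 2
    & q + 2 <= r <= 2 * q - 2 ->
      exists2 m, is_min_edges 1 q r m & m <= minn (f1 q r) (f2 q r)].
Proof.
have q0 : 0 < q by lia.
split.
- have [||m hm le] := min_edges_le_ferrers q q q0; try lia.
  by exists m => //; move: le; rewrite subnn addn0.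
- have [||m hm le] := min_edges_le_ferrers q (q + 1) q0; try lia.
  by exists m => //; move: le; rewrite addKn.
case/andP=> h1 h2.
have [||m hm le] := min_edges_le_ferrers q r q0; try lia.
exists m => //; apply: leq_trans le _.
(* Writing [r - q = d + 2] and [q = (r - q) + 2 + k] encodes the range of [r] and removes truncated
   subtraction. *)
have [d rE] : exists d, r = q + d.+2 by exists (r - q - 2); lia.
have [k qE] : exists k, q = d + k + 4 by exists (q - d - 4); lia.
have b1 : 'C(r - q + 2, 2) * 2 = (r - q + 2) * (r - q + 1).
  by have := bin_ffact (r - q + 2) 2; rewrite ffactnS ffactn1 => ->; lia.
have b2 : 'C(2 * q, 2) = q * (2 * q - 1).
  by rewrite bin2 -mulnA mul2n doubleK subn1.
rewrite leq_min /f1 /f2 b2 -mulnn.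
(* With [D = r - q], the bound by [f2] amounts to [D * (D - 1) <= q * (q - 1)]. *)
by apply/andP; split; move: b1; rewrite rE addKn; nia.
Qed.
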